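(* Let $G$ be a finitely generated group and let $S$ be a finite generating subset. (i) Assume that $G$ has an infinite subset $Y$ such that $(G,Y)$ has relative Property T. Then there exists $C>0$ such that for all finite quotients $Q$ of $G$, every function $f$ from $Q$ to a Hilbert space satisfies, for every $y\in Y$, $$\sum_{g\in Q}\|f(g\bar y)-f(g)\|^2\leqslant C\sum_{g\in Q,\,s\in S}\|f(g\bar s)-f(g)\|^2,$$ where $\bar y$ and $\bar s$ denote the projections of $y$ and $s$ in $Q$. (ii) If one only assumes that $G$ does not have the Haagerup property, then there exist $C>0$ and a sequence of probability measures $\mu_n$ on $G$ whose supports $W_n$ are finite and satisfy $d(e,W_n)\to\infty$, such that for all $n\in\mathbb{N}$ and all finite quotients $Q$ of $G$, every function $f$ from $Q$ to a Hilbert space satisfies $$\sum_{g\in Q}\Big(\sum_{y\in W_n}\|f(g\bar y)-f(g)\|^2\mu_n(y)\Big)\leqslant C\sum_{g\in Q,\,s\in S}\|f(g\bar s)-f(g)\|^2 .$$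
   Context: Let $G$ be a discrete countable group and $(\mathcal{H},\pi)$ an orthogonal representation of $G$ in a Hilbert space. A sequence $(v_n)$ of unit vectors of $\mathcal{H}$ is almost invariant if for all $g\in G$, $\|\pi(g)v_n-v_n\|\to0$ as $n\to\infty$. For an infinite subset $Y\subseteq G$, the pair $(G,Y)$ has relative Property T if for every almost invariant sequence $(v_n)$ (in every orthogonal representation), $\sup_{y\in Y}\|\pi(y)v_n-v_n\|\to0$ as $n\to\infty$. Equivalently, for every affine isometric action of $G$ on a Hilbert space, the orbits of $Y$ are bounded. Every affine isometric action of $G$ on a Hilbert space $\mathcal{H}$ has the form $\sigma(g)v=\pi(g)v+b(g)$ with $\pi$ a norm-preserving representation and $b$ a $1$-cocycle. The group $G$ has the Haagerup property if it admits an affine isometric action on a Hilbert space such that $b$ is a coarse embedding (i.e. the action is metrically proper). $d$ is the word metric on $G$ associated to $S$, and $d(e,W_n)$ is the distance from $e$ to the set $W_n$. *)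

(* Defs.v *)
From HB Require Import structures.
From mathcomp Require Import all_boot all_order all_algebra all_fingroup.
From mathcomp Require Import finmap sesquilinear.
From mathcomp Require Import all_classical all_reals all_analysis.

Set Implicit Arguments.
Unset Strict Implicit.
Unset Printing Implicit Defensive.

Import Order.TTheory GRing.Theory Num.Theory.
Import numFieldNormedType.Exports.

Local Open Scope classical_set_scope.
Local Open Scope ring_scope.

(* Real Hilbert spaces; scalars are real because the representations considered
   are orthogonal ones. *)
HB.mixin Record CompleteNormedModule_isHilbert (R : realType) H
    of CompleteNormedModule R H := {
  inner : {dot H for @idfun R} ;
  inner_norm : forall v : H, inner v v = `|v| ^+ 2
}.

#[short(type="hilbertType")]
HB.structure Definition Hilbert (R : realType) :=
  {H of CompleteNormedModule_isHilbert R H & CompleteNormedModule R H}.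

Section WordMetric.
Context {G : groupType}.
Implicit Types (S : {fset G}) (g h : G) (w : seq G).

Definition words S g : set (seq G) :=
  [set w | all (fun s => (s \in S) || (s^-1%g \in S)) w
           /\ (\prod_(s <- w) s)%g = g].

Definition generates S : Prop := forall g, words S g !=set0.

(* The infimum is attained, since the set of lengths is a nonempty set of
   natural numbers as soon as S generates G. *)
Definition word_dist (R : realType) S g h : R :=
  inf [set (size w)%:R | w in words S (g^-1 * h)%g].

Definition word_dist_set (R : realType) S g (W : set G) : R :=
  inf [set word_dist R S g h | h in W].

End WordMetric.

Section Representations.
Context {R : realType} {G : groupType} {H : hilbertType R}.

Record orthogonal_rep (pi : G -> {linear H -> H}) : Prop := {
  orep1 : forall v, pi 1%g v = v ;
  orepM : forall g h v, pi (g * h)%g v = pi g (pi h v) ;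
  orep_norm : forall g v, `|pi g v| = `|v| }.

Definition almost_invariant (pi : G -> {linear H -> H}) (v : nat -> H) : Prop :=
  (forall n, `|v n| = 1) /\
  (forall g, `|pi g (v n) - v n| @[n --> \oo] --> (0 : R)).

Definition cocycle (pi : G -> {linear H -> H}) (b : G -> H) : Prop :=
  forall g h, b (g * h)%g = pi g (b h) + b g.

Definition affine_action (pi : G -> {linear H -> H}) (b : G -> H) g (v : H) : H :=
  pi g v + b g.

(* Every ball, hence every bounded set, meets only finitely many of its
   translates. *)
Definition metrically_proper (sigma : G -> H -> H) : Prop :=
  forall r : R, finite_set [set g | exists v, `|v| <= r /\ `|sigma g v| <= r].

End Representations.

(* The suprema are those of nonempty sets bounded by 2. *)
Definition relative_property_T (R : realType) (G : groupType) (Y : set G) : Prop :=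
  forall (H : hilbertType R) (pi : G -> {linear H -> H}) (v : nat -> H),
    orthogonal_rep pi -> almost_invariant pi v ->
    sup [set `|pi y (v n) - v n| | y in Y] @[n --> \oo] --> (0 : R).

Definition haagerup (R : realType) (G : groupType) : Prop :=
  exists (H : hilbertType R) (pi : G -> {linear H -> H}) (b : G -> H),
    [/\ orthogonal_rep pi, cocycle pi b & metrically_proper (affine_action pi b)].

Definition finitely_supported_probability (R : realType) (G : groupType)
    (mu : {fsfun G -> R with 0}) : Prop :=
  (forall g, 0 <= mu g) /\ \sum_(g <- finsupp mu) mu g = 1.

(* The finite quotient Q is presented by a surjective morphism p : G -> Q. *)
Definition quotient_map (G : groupType) (Q : finGroupType)
    (p : {multiplicative G -> Q}) : Prop :=
  forall q : Q, exists g, p g = q.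

(* Main.v *)
Require Import Defs.
From HB Require Import structures.
From mathcomp Require Import all_boot all_order all_algebra all_fingroup.
From mathcomp Require Import finmap sesquilinear.
From mathcomp Require Import all_classical all_reals all_analysis.
From mathcomp Require Import ring lra.

Set Implicit Arguments.
Unset Strict Implicit.
Unset Printing Implicit Defensive.

Import Order.TTheory GRing.Theory Num.Theory.
Import numFieldNormedType.Exports.

Local Open Scope classical_set_scope.
Local Open Scope ring_scope.

(** A function f on a finite quotient Q of G has a displacement function
psi(g) = sum over q of |f (q p(g)) - f q| ^ 2, and both assertions compare
psi(y), for y far away in G, with the sum D(psi) of psi over S. By Gram-Schmidt
the image of f may be placed in a Euclidean space, and psi is the sum of the
displacements of the coordinates (hilbert_displacement): only real-valued f
matter. For these, psi(g) = 2 (phi(1) - phi(g)) with phi the matrix coefficient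
of f in the regular representation on l^2(Q). Thus phi is positive definite, so
are all its powers (they are coefficients of f tensored with itself, that is, of
a function on Q^k), and psi is of conditionally negative type.

Relative Property T. If no constant works, there are f_n and y_n in Y with
psi_n(y_n) > (n + 1) D(psi_n). Normalised to phi_n(1) = 1, the coefficient need
not be far from 1 at y_n, but a suitable power of it is: with
a = 1 - phi_n(y_n) and an exponent k of order 1 / a, the power is at most 1/2 at
y_n while it is still 1 + O(1/n) on S (amplified_coefficient). These powers are
realised by unit vectors v_n in a single orthogonal representation
(pdef_family_rep). The vectors are almost invariant but are moved by at least 1
by y_n, which contradicts the assumption (relative_T_displacement).

Absence of the Haagerup property. If for each C there is an n such that no
finitely supported probability measure outside the ball of radius n satisfies
the inequality, then a minimax argument over a finite set F (minimax) exchanges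
the measure and the function: one psi of conditionally negative type, with
D(psi) <= 1, is at least C - 1 on all points of F outside the ball
(local_cnd_of_not_spreads). Let C - 1 run through the numbers k 2^k and F
through balls, sum over k with weights 2^-k, and pass to the limit along an ultrafilter. The result is a psi of
conditionally negative type with finite sublevel sets (haagerup_of_local_cnd).
By the construction of Gelfand, Naimark, Segal and Schoenberg, psi(g) = |b g|^2
for a cocycle b of an affine isometric action, which is therefore proper.

The Hilbert spaces come from one construction. A positive semidefinite kernel K
on a set X defines a reproducing kernel Hilbert space of functions on X: the
functions F for which 2 <c, F> - K(c, c) is bounded above over the finitely
supported combinations c of points, with this supremum as squared norm. Being a
space of functions, it is complete without any completion or quotient, and a
group that acts on X and preserves K acts on it by translation. Its inner
product is obtained by polarisation, from the parallelogram law. *)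

(** * Finitely supported combinations of points and kernels *)

Section Pairing.
Context {R : realType} {X : Type}.
Implicit Types (c d : seq (R * X)) (F : X -> R) (K : X -> X -> R).

(** A list of weighted points stands for a formal linear combination of
points of [X]; functions on [X] extend to combinations by linearity. *)
Definition pairing c F : R := \sum_(x <- c) x.1 * F x.2.

Definition rescale (a : R) c : seq (R * X) := [seq (a * x.1, x.2) | x <- c].

Definition kform K c d : R := pairing c (fun x => pairing d (K x)).

Lemma pairing_cat c d F : pairing (c ++ d) F = pairing c F + pairing d F.
Proof. exact: big_cat. Qed.

Lemma pairing_rescale a c F : pairing (rescale a c) F = a * pairing c F.
Proof.
by rewrite /pairing big_map mulr_sumr; apply: eq_bigr => x _; rewrite mulrA.
Qed.

Lemma pairingD c F F' : pairing c (F + F') = pairing c F + pairing c F'.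
Proof.
by rewrite /pairing -big_split; apply: eq_bigr => x _; exact: mulrDr.
Qed.

Lemma pairingZ c a F : pairing c (a *: F) = a * pairing c F.
Proof.
by rewrite /pairing mulr_sumr; apply: eq_bigr => x _; rewrite mulrCA.
Qed.

Lemma eq_pairing c F F' : F =1 F' -> pairing c F = pairing c F'.
Proof. by move=> e; apply: eq_bigr => x _; rewrite e. Qed.

Lemma kform_catl K c c' d : kform K (c ++ c') d = kform K c d + kform K c' d.
Proof. exact: pairing_cat. Qed.

Lemma kform_catr K c d d' : kform K c (d ++ d') = kform K c d + kform K c d'.
Proof.
rewrite -pairingD; apply: eq_pairing => x; exact: pairing_cat.
Qed.

Lemma kform_rescalel K a c d : kform K (rescale a c) d = a * kform K c d.
Proof. exact: pairing_rescale. Qed.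

Lemma kform_rescaler K a c d : kform K c (rescale a d) = a * kform K c d.
Proof.
rewrite -pairingZ; apply: eq_pairing => x; exact: pairing_rescale.
Qed.

Lemma kform_sym K c d :
  (forall x y, K x y = K y x) -> kform K c d = kform K d c.
Proof.
move=> Ksym; rewrite /kform /pairing.
under eq_bigr do rewrite mulr_sumr.
rewrite exchange_big; apply: eq_bigr => y _.
by rewrite mulr_sumr; apply: eq_bigr => x _; rewrite Ksym mulrCA.
Qed.

End Pairing.

Section KernelOps.
Context {R : realType} {X Y : Type}.
Implicit Types (c d : seq (R * X)) (K : X -> X -> R).

Lemma kformDK K K' c d :
  kform (fun x y => K x y + K' x y) c d = kform K c d + kform K' c d.
Proof.
rewrite -pairingD; apply: eq_pairing => x; exact: pairingD.
Qed.

Lemma kformZK a K c d : kform (fun x y => a * K x y) c d = a * kform K c d.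
Proof. rewrite -pairingZ; apply: eq_pairing => x; exact: pairingZ. Qed.

Lemma eq_kform K K' c d : K =2 K' -> kform K c d = kform K' c d.
Proof.
by move=> e; apply: eq_pairing => x; apply: eq_pairing => y; rewrite e.
Qed.

Lemma kform_map (f g : Y -> X) K (c d : seq (R * Y)) :
  kform K [seq (p.1, f p.2) | p <- c] [seq (p.1, g p.2) | p <- d] =
  kform (fun x y => K (f x) (g y)) c d.
Proof.
rewrite /kform /pairing big_map; apply: eq_bigr => x _ /=.
by rewrite big_map.
Qed.

Lemma kform_prod (a b : X -> R) c d :
  kform (fun x y => a x * b y) c d = pairing c a * pairing d b.
Proof.
rewrite mulrC -pairingZ; apply: eq_pairing => x.
by rewrite -[RHS]/(pairing d b * a x) mulrC -pairingZ.
Qed.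

Lemma kform_sum (I : finType) (K : I -> X -> X -> R) c d :
  kform (fun x y => \sum_i K i x y) c d = \sum_i kform (K i) c d.
Proof.
have pairing_sum e (F : I -> X -> R) :
    pairing e (fun x => \sum_i F i x) = \sum_i pairing e (F i).
  by rewrite /pairing exchange_big; apply: eq_bigr => x _; rewrite mulr_sumr.
by rewrite -pairing_sum; apply: eq_pairing => x; exact: pairing_sum.
Qed.

End KernelOps.

Record pskernel (R : realType) (X : Type) := PSKernel {
  kfun :> X -> X -> R ;
  ksym : forall x y, kfun x y = kfun y x ;
  kpos : forall c, 0 <= kform kfun c c }.

Section RKHS.
Context {R : realType} {X : Type} (K : pskernel R X).
Implicit Types (c d : seq (R * X)) (F G : X -> R) (M : R).

(** For fixed [c] this is the Legendre form of
[<c, F> ^ 2 <= M * K(c, c)] (see [sqboundP]). Unlike the quotient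
[<c, F> ^ 2 / K(c, c)], it makes sense for degenerate [c] and is affine in [F],
which gives the parallelogram law at once. *)
Definition sqbound F M : Prop :=
  forall c, pairing c F *+ 2 - kform K c c <= M.

Definition rkhs_pred : {pred X -> R} := [pred F | `[< exists M, sqbound F M >]].

Definition sqnorm F : R := inf [set M | sqbound F M].

Lemma sqbound_ge0 F M : sqbound F M -> 0 <= M.
Proof. by move=> /(_ [::]); rewrite /kform /pairing !big_nil mul0rn subr0. Qed.

(** Replacing [c] by [t c] turns the left-hand side into the statement that a
quadratic polynomial in [t] is bounded by [M]; optimise over [t]. *)
Lemma sqboundP F M :
  sqbound F M <-> 0 <= M /\ forall c, pairing c F ^+ 2 <= M * kform K c c.
Proof.
split=> [b|[M0 b] c].
  split; first exact: sqbound_ge0 b.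
  move=> c; have h t : t * pairing c F *+ 2 - t ^+ 2 * kform K c c <= M.
    have := b (rescale t c).
    by rewrite pairing_rescale kform_rescalel kform_rescaler mulrA -expr2.
  have := kpos K c; have M0 := sqbound_ge0 b.
  move: h; set p := pairing c F; set k := kform K c c => h.
  (* a degenerate combination must pair to zero with F: scale it up *)
  rewrite le_eqVlt => /predU1P[k0|k0].
    rewrite -k0 mulr0; have [->|p0] := eqVneq p 0; first by rewrite expr0n.
    have := h ((M + 1) / p); rewrite -k0 mulr0 subr0 divfK// mulr2n. lra.
  have := h (p / k); rewrite -(ler_pM2r k0); apply: le_trans.
  by rewrite le_eqVlt; apply/orP; left; apply/eqP; field; rewrite gt_eqF.
have k0 := kpos K c; have := b c.
move: (pairing c F) (kform K c c) k0 => p k k0 h.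
rewrite mulr2n leNgt; apply/negP => lt.
have lt2 : (M + k) ^+ 2 < (p + p) ^+ 2 by rewrite ltr_sqr ?nnegrE; lra.
have := sqr_ge0 (M - k); nra.
Qed.

Lemma sqnormP F : F \in rkhs_pred -> sqbound F (sqnorm F).
Proof.
move=> /asboolP[M bM] c; apply: lb_le_inf; first by exists M.
by move=> M' /(_ c).
Qed.

Lemma sqnorm_le F M : sqbound F M -> sqnorm F <= M.
Proof. by move=> b; apply: ge_inf => //; exists 0 => M' /sqbound_ge0. Qed.

Lemma sqbound_rkhs F M : sqbound F M -> F \in rkhs_pred.
Proof. by move=> b; apply/asboolP; exists M. Qed.

Lemma sqnorm_ge0 F : F \in rkhs_pred -> 0 <= sqnorm F.
Proof. by move=> /sqnormP /sqbound_ge0. Qed.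

Lemma pairing_le F c : F \in rkhs_pred ->
  `|pairing c F| <= Num.sqrt (sqnorm F) * Num.sqrt (kform K c c).
Proof.
move=> FK; have /sqboundP[q0 /(_ c)] := sqnormP FK.
by rewrite -sqrtrM// -sqrtr_sqr => h; rewrite ler_wsqrtr.
Qed.

Lemma sqbound_of_le F M : 0 <= M ->
  (forall c, `|pairing c F| <= M * Num.sqrt (kform K c c)) ->
  sqbound F (M ^+ 2).
Proof.
move=> M0 h; apply/sqboundP; split; first exact: sqr_ge0.
move=> c; have := h c; rewrite -ler_sqr ?nnegrE ?mulr_ge0//.
by rewrite exprMn sqr_sqrtr ?kpos// -normrX ger0_norm ?sqr_ge0.
Qed.

Lemma sqboundD F G M N : 0 <= M -> 0 <= N ->
  sqbound F (M ^+ 2) -> sqbound G (N ^+ 2) -> sqbound (F + G) ((M + N) ^+ 2).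
Proof.
move=> M0 N0 bF bG.
apply: sqbound_of_le; first exact: addr_ge0.
move=> c; rewrite pairingD mulrDl (le_trans (ler_normD _ _))// lerD//.
  apply: le_trans (pairing_le c (sqbound_rkhs bF)) _.
  rewrite ler_wpM2r// -[leRHS]ger0_norm// -sqrtr_sqr ler_wsqrtr//.
  exact: sqnorm_le.
apply: le_trans (pairing_le c (sqbound_rkhs bG)) _.
rewrite ler_wpM2r// -[leRHS]ger0_norm// -sqrtr_sqr ler_wsqrtr//.
exact: sqnorm_le.
Qed.

Lemma sqboundZ a F M : sqbound F M -> sqbound (a *: F) (a ^+ 2 * M).
Proof.
move=> /sqboundP[M0 b]; apply/sqboundP; split.
  by rewrite mulr_ge0 ?sqr_ge0.
by move=> c; rewrite pairingZ exprMn -[leRHS]mulrA ler_wpM2l ?sqr_ge0.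
Qed.

Lemma sqbound0 : sqbound 0 0.
Proof.
move=> c; rewrite /pairing big1 => [|x _]; last by rewrite mulr0.
by rewrite mul0rn sub0r oppr_le0 kpos.
Qed.

Lemma rkhs_submod_closed : submod_closed rkhs_pred.
Proof.
split; first exact: sqbound_rkhs sqbound0.
move=> a F G FK GK.
have bF := sqnormP FK; have bG := sqnormP GK.
have bF' := sqboundZ a bF.
pose M := `|a| * Num.sqrt (sqnorm F) + Num.sqrt (sqnorm G).
apply: (@sqbound_rkhs _ (M ^+ 2)).
apply: sqboundD; rewrite ?mulr_ge0//.
  by rewrite exprMn real_normK ?num_real// sqr_sqrtr ?sqnorm_ge0.
by rewrite sqr_sqrtr ?sqnorm_ge0.
Qed.

HB.instance Definition _ :=
  GRing.isSubmodClosed.Build R (X -> R) rkhs_pred rkhs_submod_closed.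

Record rkhs := RKHS { rkval :> X -> R ; _ : rkval \in rkhs_pred }.

HB.instance Definition _ := [isSub for rkval].
HB.instance Definition _ := [Choice of rkhs by <:].
HB.instance Definition _ := [SubChoice_isSubLmodule of rkhs by <:].

End RKHS.

(** * The norm of a reproducing kernel Hilbert space *)

Section RKHSNorm.
Context {R : realType} {X : Type} (K : pskernel R X).
Implicit Types (c d : seq (R * X)) (F G : rkhs K) (M : R).

Lemma rkvalP F : rkval F \in rkhs_pred K.
Proof. exact: valP. Qed.

Definition rknorm F : R := Num.sqrt (sqnorm K F).

Lemma rknorm_ge0 F : 0 <= rknorm F. Proof. exact: sqrtr_ge0. Qed.

Lemma sqr_rknorm F : rknorm F ^+ 2 = sqnorm K F.
Proof. by rewrite sqr_sqrtr ?sqnorm_ge0 ?rkvalP. Qed.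

Lemma rknorm_le F M : 0 <= M -> sqbound K F (M ^+ 2) -> rknorm F <= M.
Proof.
move=> M0 /sqnorm_le h.
by rewrite -ler_sqr ?nnegrE ?rknorm_ge0// sqr_rknorm.
Qed.

Lemma rknorm_triangle F G : rknorm (F + G) <= rknorm F + rknorm G.
Proof.
apply: rknorm_le; first by rewrite addr_ge0 ?rknorm_ge0.
by apply: sqboundD; rewrite ?rknorm_ge0// sqr_rknorm; apply/sqnormP/rkvalP.
Qed.

Lemma sqnormZ a F : sqnorm K (rkval (a *: F)) = a ^+ 2 * sqnorm K F.
Proof.
have le b G : sqnorm K (rkval (b *: G)) <= b ^+ 2 * sqnorm K G.
  exact/sqnorm_le/sqboundZ/sqnormP/rkvalP.
apply/eqP; rewrite eq_le le andTb; have [->|a0] := eqVneq a 0.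
  by rewrite scale0r expr0n mul0r sqnorm_ge0 ?rkvalP.
have := le a^-1 (a *: F); rewrite scalerA mulVf// scale1r => h.
by rewrite -ler_pdivlMl ?exprn_even_gt0// -exprVn.
Qed.

Lemma rknormZ a F : rknorm (a *: F) = `|a| * rknorm F.
Proof. by rewrite /rknorm sqnormZ sqrtrM ?sqr_ge0// sqrtr_sqr. Qed.

(** Evaluation at [x] is bounded, since [x] is itself a combination, of
squared norm [K x x]. *)
Lemma rkval_le F x : `|F x| <= rknorm F * Num.sqrt (K x x).
Proof.
have := pairing_le [:: (1, x)] (rkvalP F).
by rewrite /kform /pairing !big_seq1 !mul1r.
Qed.

Lemma rknorm_eq0 F : rknorm F = 0 -> F = 0.
Proof.
move=> F0; apply/val_inj/funext => x /=; apply/eqP.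
by have := rkval_le F x; rewrite F0 mul0r normr_le0.
Qed.

HB.instance Definition _ := Lmodule_isNormed.Build R (rkhs K)
  rknorm_triangle rknormZ rknorm_eq0.

Lemma rknormE F : `|F| = rknorm F. Proof. by []. Qed.

Lemma normr_le_sqbound F M : 0 <= M -> sqbound K F (M ^+ 2) -> `|F| <= M.
Proof. exact: rknorm_le. Qed.

Lemma pairing_le_norm c F : `|pairing c F| <= `|F| * Num.sqrt (kform K c c).
Proof. exact/pairing_le/rkvalP. Qed.

Lemma pairingB c F G : pairing c (F - G) = pairing c F - pairing c G.
Proof. by rewrite -[in RHS]mulN1r -pairingZ -pairingD scaleN1r. Qed.

(** A Cauchy filter converges pointwise, because evaluations are Lipschitz; the
bounds that define the norm pass to the pointwise limit. *)
Lemma rkhs_complete (A : set_system (rkhs K)) :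
  ProperFilter A -> cauchy A -> cvg A.
Proof.
move=> PA /cauchyP cA.
have /choice[f ptcvg] : forall x : X, exists l : R, F x @[F --> A] --> l.
  move=> x; apply/cvg_ex; apply: cauchy_cvg; apply: cauchy_exP => e e0.
  have s0 : 0 < Num.sqrt (K x x) + 1 by rewrite ltr_wpDl ?sqrtr_ge0.
  have [F0 AF0] := cA _ (divr_gt0 e0 s0).
  exists (F0 x); change (A [set F : rkhs K | ball (F0 x) e (F x)]).
  apply: filterS AF0 => F; rewrite -ball_normE /= => h.
  rewrite -ball_normE /=; have := rkval_le (F0 - F) x; move/le_lt_trans; apply.
  rewrite -rknormE; move: h; rewrite ltr_pdivlMr// => /(le_lt_trans _); apply.
  by rewrite ler_wpM2l// lerDl.
have paircvg c : (fun F : rkhs K => pairing c F) @ A --> pairing c f.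
  apply: cvg_big => [|x _]; first exact: add_continuous.
  exact: cvgMl_tmp (ptcvg x.2).
have near_f e F0 : 0 < e -> A (ball F0 e) -> sqbound K (f - F0) (e ^+ 2).
  move=> e0 AF0; apply: sqbound_of_le; first exact: ltW.
  move=> c; have -> : pairing c (f - F0) = pairing c f - pairing c F0.
    by rewrite -[in RHS]mulN1r -pairingZ -pairingD scaleN1r.
  have /cvgr_to_le : `|pairing c F - pairing c F0| @[F --> A]
      --> `|pairing c f - pairing c F0|.
    by apply: cvg_norm; apply: cvgB; [exact: paircvg|apply: cvg_cst].
  apply; apply: (@filterS _ A _ (ball F0 e)) => // F.
  rewrite -ball_normE /= distrC => /ltW h.
  by rewrite -pairingB (le_trans (pairing_le_norm _ _))// ler_wpM2r ?sqrtr_ge0.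
have fK : f \in rkhs_pred K.
  have [F0 AF0] := cA _ ltr01.
  rewrite -[f](subrK (rkval F0)) rpredD ?rkvalP//.
  exact: sqbound_rkhs (near_f _ _ ltr01 AF0).
apply/cvg_ex; exists (RKHS fK); apply/cvgrPdist_le => e e0.
have e20 : 0 < e / 2 by rewrite divr_gt0.
have [F0 AF0] := cA _ e20.
apply: (@filterS _ A _ (ball F0 (e / 2))) => // F.
rewrite -ball_normE /= => /ltW h.
rewrite -(subrKA F0) [e]splitr (le_trans (ler_normD _ _))// lerD//.
by apply: normr_le_sqbound; [exact: ltW|exact: near_f].
Qed.

HB.instance Definition _ := Uniform_isComplete.Build (rkhs K) rkhs_complete.

End RKHSNorm.

(** * Inner products from the parallelogram law *)

Section AdditiveBounded.
Context {R : realType}.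

(** Additivity gives linearity over the integers. For real [x], comparing
[n x] with its integer part shows that [n * |h x - x * h 1|] stays below a
constant independent of [n]. *)
Lemma additive_bounded_linear (h : R -> R) (M : R) :
  (forall x y, h (x + y) = h x + h y) -> (forall x, `|h x| <= M * `|x|) ->
  forall x, h x = x * h 1.
Proof.
move=> hD hM x.
have h0 : h 0 = 0 by apply: (addrI (h 0)); rewrite -hD !addr0.
have hn n y : h (y *+ n) = h y *+ n.
  by elim: n => [|n IH]; rewrite ?mulr0n// !mulrS hD IH.
have hN y : h (- y) = - h y.
  by apply: (addrI (h y)); rewrite -hD !subrr.
have hz z : h z%:~R = z%:~R * h 1.
  case: z => n; first by rewrite -pmulrn hn mulr_natl.
  by rewrite NegzE mulrNz hN -pmulrn hn mulNr mulr_natl.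
have M0 : 0 <= M by have := hM 1; rewrite normr1 mulr1; exact: le_trans.
apply/eqP; rewrite -subr_eq0 -normr_eq0; apply/eqP.
set e := `|_|; apply/eqP; rewrite eq_le normr_ge0 andbT.
apply/ler_addgt0Pl => d d0; rewrite addr0.
pose n := (Num.trunc ((M + `|h 1|) / d)).+1.
have n0 : 0 < n%:R :> R by [].
have nd : M + `|h 1| <= d * n%:R.
  by rewrite -ler_pdivrMl// mulrC ltW// truncnS_gt.
rewrite -(ler_pM2r n0); apply: le_trans nd.
have nx : 0 <= n%:R * x - (Num.floor (n%:R * x))%:~R <= 1.
  have /andP[h1 h2] := floor_itv (n%:R * x).
  rewrite intrD in h2; lra.
have -> : e * n%:R =
    `|h (n%:R * x - (Num.floor (n%:R * x))%:~R)
      - (n%:R * x - (Num.floor (n%:R * x))%:~R) * h 1|.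
  rewrite hD hN hz mulr_natl hn /e -[in LHS](@ger0_norm _ n%:R)// -normrM.
  by congr `|_|; rewrite -mulr_natl; ring.
case/andP: nx; set y := _ - _ => y0 y1.
rewrite (le_trans (ler_normB _ _))// lerD//.
  by rewrite (le_trans (hM _))// ger0_norm// ler_piMr.
by rewrite normrM ger0_norm// ler_piMl.
Qed.

End AdditiveBounded.

Section JordanVonNeumann.
Context {R : realType} {V : normedModType R}.
Implicit Types u v w : V.

(** The polarisation identity makes this the only candidate for an inner
product that induces the norm. *)
Definition polar u v : R := (`|u + v| ^+ 2 - `|u - v| ^+ 2) / 4.

Lemma polarC u v : polar u v = polar v u.
Proof. by rewrite /polar (addrC u v) distrC. Qed.

Lemma polar_norm v : polar v v = `|v| ^+ 2.
Proof.
rewrite /polar subrr normr0 -mulr2n -scaler_nat normrZ ger0_norm//.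
by field.
Qed.

Hypothesis parallelogram : forall u v,
  `|u + v| ^+ 2 + `|u - v| ^+ 2 = (`|u| ^+ 2 + `|v| ^+ 2) *+ 2.

(** The Jordan-von Neumann argument: four instances of the parallelogram law,
in which the terms in [u - v] cancel. *)
Lemma polarDl u v w : polar (u + v) w = polar u w + polar v w.
Proof.
have e1 := parallelogram (u + w) v.
have e2 := parallelogram (v + w) u.
have e3 := parallelogram (u - w) v.
have e4 := parallelogram (v - w) u.
have r1 : u + w + v = u + v + w by rewrite addrAC.
have r2 : v + w + u = u + v + w by rewrite addrAC (addrC v).
have r3 : u - w + v = u + v - w by rewrite addrAC.
have r4 : v - w + u = u + v - w by rewrite addrAC (addrC v).
have r5 : `|v + w - u| = `|u - w - v|.
  rewrite -normrN !opprD opprK addrC addrA.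
  by rewrite addrAC.
have r6 : `|v - w - u| = `|u + w - v|.
  by rewrite -normrN !opprD !opprK addrC addrA addrAC.
rewrite r1 in e1; rewrite r2 r5 in e2; rewrite r3 in e3; rewrite r4 r6 in e4.
rewrite /polar; lra.
Qed.

(** Both norms lie between [| |u| - |v| |] and [|u| + |v|]; the bound on
[polar] is a quarter of the difference of the squares. *)
Lemma polar_le u v : `|polar u v| <= `|u| * `|v|.
Proof.
have d1 := ler_normD u v; have d2 := ler_normB u v.
have d3 := lerB_dist u v; have d4 := lerB_dist v u.
have d5 := lerB_normD u v; have d6 := lerB_normD v u.
rewrite (addrC v u) in d6; rewrite (distrC v u) in d4.
rewrite ler_norml /polar; move: d1 d2 d3 d4 d5 d6.
have := normr_ge0 u; have := normr_ge0 v.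
have := normr_ge0 (u + v); have := normr_ge0 (u - v).
move: `|u| `|v| `|u + v| `|u - v| => a b s t t0 s0 b0 a0 d1 d2 d3 d4 d5 d6.
have s2 : s ^+ 2 <= (a + b) ^+ 2 by rewrite ler_sqr ?nnegrE ?addr_ge0.
have t2 : t ^+ 2 <= (a + b) ^+ 2 by rewrite ler_sqr ?nnegrE ?addr_ge0.
have sq x : 0 <= x -> a - b <= x -> b - a <= x -> (a - b) ^+ 2 <= x ^+ 2.
  move=> x0 h1 h2; rewrite -[leLHS]real_normK ?num_real//.
  by rewrite ler_sqr ?nnegrE// ler_norml h1 lerNl opprB h2.
have := sq s s0 d5 d6; have := sq t t0 d3 d4.
move: s2 t2; rewrite !sqrrD !sqrrN mulrN => h1 h2 h3 h4.
by apply/andP; split; lra.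
Qed.

Lemma polarZl a u v : polar (a *: u) v = a * polar u v.
Proof.
rewrite -[in RHS](scale1r u).
apply: (@additive_bounded_linear _ (fun a => polar (a *: u) v) (`|u| * `|v|)).
  by move=> x y; rewrite scalerDl polarDl.
move=> x; rewrite (le_trans (polar_le _ _))// normrZ.
by rewrite -mulrA mulrC.
Qed.

End JordanVonNeumann.

Section RKHSInner.
Context {R : realType} {X : Type} (K : pskernel R X).
Implicit Types (c d : seq (R * X)) (F G : rkhs K).

Lemma sqr_normE F : `|F| ^+ 2 = sqnorm K F.
Proof. exact: sqr_rknorm. Qed.

(** For combinations [c] and [d], the bounds for [F + G] at [c] and for [F - G]
at [d] add up to the bounds for [F] and [G] at [(c + d) / 2] and [(c - d) / 2],
twice over; then take suprema in [c] and [d]. *)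
Lemma rkhs_parallelogram_le F G :
  `|F + G| ^+ 2 + `|F - G| ^+ 2 <= (`|F| ^+ 2 + `|G| ^+ 2) *+ 2.
Proof.
have key c d : (pairing c (F + G) *+ 2 - kform K c c)
    + (pairing d (F - G) *+ 2 - kform K d d) <= (`|F| ^+ 2 + `|G| ^+ 2) *+ 2.
  have bF := sqnormP (rkvalP F) (rescale 2^-1 (c ++ d)).
  have bG := sqnormP (rkvalP G) (rescale 2^-1 (c ++ rescale (-1) d)).
  rewrite !sqr_normE; move: bF bG.
  rewrite !(pairing_rescale, pairing_cat, kform_rescalel, kform_rescaler,
    kform_catl, kform_catr) pairingB pairingD (kform_sym d c (ksym K)).
  move: (pairing c F) (pairing c G) (pairing d F) (pairing d G).
  by move: (kform K c c) (kform K c d) (kform K d d) => *; lra.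
rewrite -lerBrDl sqr_normE; apply: sqnorm_le => d.
rewrite lerBrDl -lerBrDr sqr_normE; apply: sqnorm_le => c.
by rewrite lerBrDr.
Qed.

Lemma rkhs_parallelogram F G :
  `|F + G| ^+ 2 + `|F - G| ^+ 2 = (`|F| ^+ 2 + `|G| ^+ 2) *+ 2.
Proof.
apply/eqP; rewrite eq_le rkhs_parallelogram_le andTb.
(* the reverse inequality is the same one for the sum and the difference *)
have := rkhs_parallelogram_le (F + G) (F - G).
have -> : F + G + (F - G) = 2 *: F by rewrite addrACA subrr addr0 scaler_nat.
have -> : F + G - (F - G) = 2 *: G.
  by rewrite opprB (addrC F) addrACA subrr addr0 scaler_nat.
rewrite !normrZ !exprMn ger0_norm//; lra.
Qed.

Definition rkinner : rkhs K -> rkhs K -> R := polar.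

Lemma rkinner_bilinear : bilinear_for *%R (idfun \; *%R) rkinner.
Proof.
have par := rkhs_parallelogram; split=> u a v w.
  by rewrite /rkinner polarDl// polarZl.
by rewrite /rkinner polarC polarDl// polarZl// !(polarC u).
Qed.

HB.instance Definition _ :=
  bilinear_isBilinear.Build R (rkhs K) (rkhs K) R *%R (idfun \; *%R) rkinner
    rkinner_bilinear.

Lemma rkinner_hermitian F G : rkinner F G = (-1) ^+ false * idfun (rkinner G F).
Proof. by rewrite expr0 mul1r /rkinner polarC. Qed.

HB.instance Definition _ :=
  isHermitianSesquilinear.Build R (rkhs K) false idfun rkinner
    rkinner_hermitian.

Lemma rkinner_gt0 F : F != 0 -> 0 < rkinner F F.
Proof. by move=> F0; rewrite /rkinner polar_norm exprn_gt0// normr_gt0. Qed.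

HB.instance Definition _ := isDotProduct.Build R (rkhs K) rkinner rkinner_gt0.

HB.instance Definition _ :=
  @CompleteNormedModule_isHilbert.Build R (rkhs K) rkinner
    (@polar_norm R (rkhs K)).

End RKHSInner.

(** * Orthogonal representations from invariant kernels *)

Section KernelVectors.
Context {R : realType} {X : Type} (K : pskernel R X).
Implicit Types (c d : seq (R * X)) (x y : X).

(** [K(c, c)] bounds [2 K(d, c) - K(d, d)] because [K(c - d, c - d)] is
nonnegative. *)
Lemma kcomb_sqbound c : sqbound K (fun x => pairing c (K x)) (kform K c c).
Proof.
move=> d; rewrite -[pairing d _]/(kform K d c).
have := kpos K (c ++ rescale (-1) d).
rewrite !(kform_catl, kform_catr, kform_rescalel, kform_rescaler).
rewrite (kform_sym c d (ksym K)); lra.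
Qed.

Definition kcomb c : rkhs K := RKHS (sqbound_rkhs (kcomb_sqbound c)).

(** The supremum that defines the squared norm is attained at [c] itself. *)
Lemma normr_kcomb c : `|kcomb c| ^+ 2 = kform K c c.
Proof.
rewrite sqr_normE; apply/eqP.
rewrite eq_le (sqnorm_le (kcomb_sqbound c)) andTb.
have := sqnormP (rkvalP (kcomb c)) c.
by rewrite -[pairing c _]/(kform K c c) mulr2n addrK.
Qed.

Definition kvec x : rkhs K := kcomb [:: (1, x)].

Lemma kvecE x y : kvec x y = K y x.
Proof. by rewrite /kvec/= /pairing big_seq1 mul1r. Qed.

Lemma normr_kvec x : `|kvec x| ^+ 2 = K x x.
Proof. by rewrite normr_kcomb /kform /pairing !big_seq1 !mul1r. Qed.

Lemma normr_kvecB x y : `|kvec x - kvec y| ^+ 2 = K x x - K x y *+ 2 + K y y.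
Proof.
have -> : kvec x - kvec y = kcomb [:: (1, x); (-1, y)].
  apply/val_inj/funext => z.
  rewrite -[LHS]/(kvec x z - kvec y z) !kvecE /= /pairing !big_cons big_nil /=.
  by ring.
rewrite normr_kcomb /kform /pairing !big_cons !big_nil /= (ksym K y x).
by ring.
Qed.

Section Action.
Context {G : groupType} (act : G -> X -> X).
Hypothesis act1 : forall x, act 1%g x = x.
Hypothesis actM : forall g h x, act (g * h)%g x = act g (act h x).
Hypothesis Kact : forall g x y, K (act g x) (act g y) = K x y.

Lemma pairing_act g c (F : X -> R) :
  pairing c (F \o act g) = pairing [seq (p.1, act g p.2) | p <- c] F.
Proof. by rewrite /pairing big_map. Qed.

Lemma sqbound_act g F M : sqbound K F M -> sqbound K (F \o act g) M.
Proof.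
move=> b c; rewrite pairing_act.
have <- // : kform K [seq (p.1, act g p.2) | p <- c]
    [seq (p.1, act g p.2) | p <- c] = kform K c c.
rewrite /kform -pairing_act; apply: eq_pairing => x /=.
by rewrite -pairing_act; apply: eq_pairing => y /=.
Qed.

(** Translating functions preserves the bounds that define the norm, because
translating combinations preserves [K]. *)
Lemma kernel_rep : exists pi : G -> {linear rkhs K -> rkhs K},
  orthogonal_rep pi /\ forall g x, pi g (kvec x) = kvec (act g x).
Proof.
have transP g (F : rkhs K) : rkval F \o act g \in rkhs_pred K.
  exact/sqbound_rkhs/sqbound_act/sqnormP/rkvalP.
have actK g x : act g (act g^-1%g x) = x by rewrite -actM mulgV act1.
have actVK g x : act g^-1%g (act g x) = x by rewrite -actM mulVg act1.
pose trans g F : rkhs K := RKHS (transP g F).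
have trans_le g F : `|trans g F| <= `|F|.
  apply: normr_le_sqbound => //; apply: sqbound_act.
  by rewrite sqr_normE; apply/sqnormP/rkvalP.
have /choice[pi piE] : forall g, exists L : {linear rkhs K -> rkhs K},
    L =1 trans g^-1%g.
  move=> g; have lin : linear (trans g^-1%g).
    by move=> a F F'; apply/val_inj/funext.
  pose L : {linear rkhs K -> rkhs K} := HB.pack_for {linear rkhs K -> rkhs K}
    (trans g^-1%g) (GRing.isLinear.Build _ _ _ _ _ lin).
  by exists L.
exists pi; split; first split.
- move=> F; rewrite piE; apply/val_inj/funext => x /=.
  by rewrite invg1 act1.
- move=> g h F; rewrite !piE; apply/val_inj/funext => x /=.
  by rewrite invMg actM.
- move=> g F; rewrite piE; apply/eqP; rewrite eq_le trans_le/=.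
  have := trans_le g (trans g^-1%g F); congr (`|_| <= _).
  by apply/val_inj/funext => x /=; rewrite actVK.
move=> g x; rewrite piE; apply/val_inj/funext => y /=.
rewrite -[LHS]/(kvec x (act g^-1%g y)) -[RHS]/(kvec (act g x) y) !kvecE.
by rewrite -(Kact g) actK.
Qed.

End Action.
End KernelVectors.

(** * Functions of conditionally negative type *)

Section CND.
Context {R : realType} {G : groupType}.
Implicit Types (psi : G -> R) (g h : G) (c : seq (R * G)).

(** The left-invariant kernels on [G] are those of this form. *)
Definition translate_kernel psi g h : R := psi (g^-1 * h)%g.

(** These are exactly the squared lengths of cocycles of orthogonal
representations; [cnd_affine_action] builds the cocycle. *)
Record cnd psi : Prop := CND {
  cnd1 : psi 1%g = 0 ;
  cndV : forall g, psi g^-1%g = psi g ;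
  cnd_le0 : forall c, pairing c (fun=> 1) = 0 ->
    kform (translate_kernel psi) c c <= 0 }.

(** Conditional negativity tested on the three points [1], [g], [g * h] with
weights 1, -2, 1. *)
Lemma cnd_quasi_additive psi : cnd psi ->
  forall g h, psi (g * h)%g <= psi g *+ 2 + psi h *+ 2.
Proof.
move=> [p1 pV p0] g h.
have := p0 [:: (1, 1%g); (-2, g); (1, (g * h)%g)].
rewrite /kform /pairing !big_cons !big_nil /= /translate_kernel.
rewrite invg1 !mul1g !mulg1 mulVg mulKg invMg -[(_ * g)%g]mulgA mulVg mulg1.
rewrite -invMg mulVg !pV p1; lra.
Qed.

Lemma cnd_ge0 psi : cnd psi -> forall g, 0 <= psi g.
Proof.
move=> P g; have := cnd_quasi_additive P g g^-1%g.
by rewrite mulgV (cnd1 P) (cndV P); lra.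
Qed.

Lemma cnd0 : cnd (fun=> 0).
Proof.
split=> // c _; rewrite /kform /pairing big1// => x _.
by rewrite big1 ?mulr0// => y _; rewrite mulr0.
Qed.

Lemma cndD psi psi' : cnd psi -> cnd psi' -> cnd (psi + psi').
Proof.
move=> [p1 pV p0] [q1 qV q0]; split => [|g|c c0].
- by rewrite -[LHS]/(psi _ + psi' _) p1 q1 addr0.
- by rewrite -[LHS]/(psi _ + psi' _) pV qV.
- by rewrite [leLHS]kformDK -(addr0 0) lerD ?p0 ?q0.
Qed.

Lemma cndZ a psi : 0 <= a -> cnd psi -> cnd (a *: psi).
Proof.
move=> a0 [p1 pV p0]; split => [|g|c c0].
- by rewrite -[LHS]/(a * psi _) p1 mulr0.
- by rewrite -[LHS]/(a * psi _) pV.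
- by rewrite [leLHS]kformZK mulr_ge0_le0 ?p0.
Qed.

Lemma cnd_sum I (r : seq I) (P : pred I) (f : I -> G -> R) :
  (forall i, P i -> cnd (f i)) -> cnd (\sum_(i <- r | P i) f i).
Proof. by move=> fP; elim/big_ind: _ => //; [exact: cnd0|exact: cndD]. Qed.

(** Each defining condition involves finitely many values of the function. *)
Lemma cnd_limit T (F : set_system T) (f : T -> G -> R) psi :
  ProperFilter F -> (forall t, cnd (f t)) ->
  (forall g, f t g @[t --> F] --> psi g) -> cnd psi.
Proof.
move=> PF fP fpsi; split => [|g|c c0].
- have := fpsi 1%g.
  rewrite (_ : (fun t => f t 1%g) = fun=> 0); last first.
    by apply/funext => t; exact: cnd1.
  by move=> h; apply: (norm_cvg_unique h); exact: cvg_cst.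
- have := fpsi g^-1%g.
  rewrite (_ : (fun t => f t g^-1%g) = fun t => f t g); last first.
    by apply/funext => t; exact: cndV.
  by move=> h; apply: (norm_cvg_unique h); exact: fpsi.
- have : kform (translate_kernel (f t)) c c @[t --> F] -->
      kform (translate_kernel psi) c c.
    apply: cvg_big => [|x _]; first exact: add_continuous.
    apply: cvgMl_tmp; apply: cvg_big => [|y _]; first exact: add_continuous.
    exact: cvgMl_tmp (fpsi _).
  move=> /cvgr_to_le; apply.
  by apply: nearW => t; exact: (cnd_le0 (fP t)).
Qed.

(** Induction on a word for [g]. What matters is that the constant depends on
[g] only. *)
Lemma cnd_le_generators (S : {fset G}) : generates S -> forall g,
  exists2 L : R, 0 <= L &
    forall psi, cnd psi -> psi g <= L * \sum_(s <- S) psi s.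
Proof.
move=> genS g; have [w [wS <-]] := genS g.
elim: w wS => [_|s w IH /= /andP[sS wS]].
  by exists 0 => // psi P; rewrite big_nil (cnd1 P) mul0r.
have [L L0 LP] := IH wS; exists (2 + L *+ 2).
  by rewrite addr_ge0 ?mulrn_wge0.
move=> psi P; rewrite big_cons.
have D_ge t : t \in S -> psi t <= \sum_(s <- S) psi s.
  move=> tS; rewrite (big_fsetD1 t)//= lerDl sumr_ge0// => i _.
  exact: cnd_ge0.
have sD : psi s <= \sum_(s <- S) psi s.
  by case/orP: sS => /D_ge //; rewrite (cndV P).
have := cnd_quasi_additive P s (\prod_(s <- w) s)%g; have := LP _ P.
move: sD; move: (\sum_(s <- S) psi s) => D sD wD h.
by rewrite (le_trans h)// mulrDl mulr_natl mulrnAl lerD// lerMn2r.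
Qed.

End CND.

(** * Affine actions from functions of conditionally negative type *)

Section AffineRealization.
Context {R : realType} {G : groupType} (psi : G -> R).
Hypothesis psiP : cnd psi.

Local Notation k := (translate_kernel psi).

(** A pair [(g, h)] stands for the vector [b g - b h], where the sought
cocycle [b] satisfies [|b g - b h| ^ 2 = psi (g^-1 * h)]; this is the inner
product of two such vectors. On pairs, unlike on single points, the kernel is
invariant under left translation. *)
Definition diff_kernel (x y : G * G) : R :=
  2^-1 * (k x.1 y.2 + k x.2 y.1 + -1 * (k x.1 y.1 + k x.2 y.2)).

Lemma diff_kernel_sym x y : diff_kernel x y = diff_kernel y x.
Proof.
have kC g h : k g h = k h g.
  by rewrite /translate_kernel -(cndV psiP) invMg invgK.
rewrite /diff_kernel (kC x.1 y.2) (kC x.2 y.1) (kC x.1 y.1) (kC x.2 y.2).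
by rewrite (addrC (k y.2 x.1)).
Qed.

(** Replacing each pair [(g, h)] by the difference of its two points turns [c]
into a combination of total weight zero. *)
Lemma diff_kernel_pos c : 0 <= kform diff_kernel c c.
Proof.
pose a := [seq (p.1, p.2.1) | p <- c]; pose b := [seq (p.1, p.2.2) | p <- c].
have := cnd_le0 psiP (c := a ++ rescale (-1) b).
rewrite pairing_cat pairing_rescale {1 2}/pairing !big_map mulN1r subrr.
move=> /(_ erefl).
rewrite !(kform_catl, kform_catr, kform_rescalel, kform_rescaler).
rewrite /diff_kernel kformZK kformDK kformZK !kformDK !kform_map.
by lra.
Qed.

Definition diff_pskernel := PSKernel diff_kernel_sym diff_kernel_pos.

Lemma cnd_affine_action : exists (H : hilbertType R) (pi : G -> {linear H -> H})
    (b : G -> H),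
  [/\ orthogonal_rep pi, cocycle pi b & forall g, `|b g| ^+ 2 = psi g].
Proof.
pose act g (x : G * G) := (g * x.1, g * x.2)%g.
have [pi [rep pik]] := @kernel_rep R _ diff_pskernel G act
  (fun x => ltac:(by rewrite /act !mul1g; case: x))
  (fun g h x => ltac:(by rewrite /act !mulgA))
  (fun g x y => ltac:(by rewrite /= /diff_kernel /translate_kernel /= !invMg
      -!mulgA !mulKg)).
exists (rkhs diff_pskernel), pi, (fun g => kvec diff_pskernel (g, 1%g)).
split=> //.
- move=> g h; rewrite pik; apply/val_inj/funext => x.
  rewrite -[RHS]/(kvec diff_pskernel (act g (h, 1%g)) x +
    kvec diff_pskernel (g, 1%g) x) -[LHS]/(kvec _ _ _) !kvecE /=.
  by rewrite /diff_kernel /= mulg1; ring.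
- move=> g; rewrite normr_kvec /= /diff_kernel /translate_kernel /=.
  by rewrite mulg1 invg1 !mulVg !mul1g (cndV psiP) (cnd1 psiP); field.
Qed.

End AffineRealization.

(** An element that moves some point of the ball of radius [r] into that ball
satisfies [|b g| <= 2 r]. *)
Lemma proper_cnd_haagerup (R : realType) (G : groupType) (psi : G -> R) :
  cnd psi -> (forall r : R, finite_set [set g | psi g <= r]) -> haagerup R G.
Proof.
move=> psiP fin; have [H [pi [b [rep coc bE]]]] := cnd_affine_action psiP.
exists H, pi, b; split=> // r.
apply: sub_finite_set (fin ((r + r) ^+ 2)) => g [v [v_le gv_le]] /=.
have bg : `|b g| <= r + r.
  have -> : b g = affine_action pi b g v - pi g v.
    by rewrite /affine_action addrC addKr.
  by rewrite (le_trans (ler_normB _ _))// lerD// (orep_norm rep).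
have r0 : 0 <= r + r by exact: le_trans bg.
by rewrite -bE ler_sqr ?nnegrE.
Qed.

(** * Euclidean coordinates for finite subsets of a Hilbert space *)

Section EuclideanCoordinates.
Context {R : realType} {H : hilbertType R}.
Implicit Types u v e : H.

Lemma innerC u v : inner u v = inner v u.
Proof. by rewrite [LHS]hermC/= expr0 mul1r. Qed.

Lemma innerBl u v e : inner (u - v) e = inner u e - inner v e.
Proof. exact: linearBl. Qed.

Lemma innerZl (a : R) u v : inner (a *: u) v = a * inner u v.
Proof. exact: linearZl_LR. Qed.

(** Pythagoras, for the component of [v] along [e] and the remainder. *)
Lemma unit_component e v : `|e| = 1 ->
  `|v| ^+ 2 = inner v e ^+ 2 + `|v - inner v e *: e| ^+ 2.
Proof.
move=> e1; have ee : inner e e = 1 by rewrite inner_norm e1 expr1n.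
rewrite -!inner_norm innerBl innerZl (innerC v (v - _)) (innerC e (v - _)).
rewrite !innerBl !innerZl ee.
by rewrite (innerC e); ring.
Qed.

(** Gram-Schmidt: split off the component along one nonzero value of [f].
The remainder vanishes at one more point, so the process stops. *)
Lemma euclidean_coordinates (T : finType) (f : T -> H) :
  exists fs : seq (T -> R), forall q q',
    `|f q - f q'| ^+ 2 = \sum_(h <- fs) (h q - h q') ^+ 2.
Proof.
have [n] := ubnP #|[pred q | f q != 0]|; elim: n f => // n IH f.
have [q0 fq0|f0 _] := pickP [pred q | f q != 0]; last first.
  exists [::] => q q'; rewrite big_nil.
  have fE x : f x = 0 by apply/eqP; have /negbFE := f0 x.
  by rewrite !fE subrr normr0 expr0n.
rewrite ltnS => fn; pose e := `|f q0|^-1 *: f q0.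
have e1 : `|e| = 1.
  by rewrite normrZ normrV ?unitfE ?normr_eq0// normr_id mulVf ?normr_eq0.
pose h q := inner (f q) e; pose f' q := f q - h q *: e.
have [|fs fsE] := IH f'.
  apply: leq_trans fn; apply: proper_card; apply/properP; split.
    apply/fintype.subsetP => q; rewrite !inE; apply: contra => /eqP fq.
    by rewrite /f' /h fq -(scale0r (0 : H)) innerZl mul0r !scale0r subrr.
  exists q0; rewrite ?inE// negbK /f' /h /e innerC innerZl inner_norm scalerA.
  set a := `|_|; have -> : a^-1 * a ^+ 2 * a^-1 = 1 by field; rewrite normr_eq0.
  by rewrite scale1r subrr eqxx.
exists (h :: fs) => q q'; rewrite big_cons -fsE.
rewrite (unit_component (f q - f q') e1) innerBl; congr (_ + `|_| ^+ 2).
by rewrite /f' scalerBl !opprB [LHS]addrACA [RHS]addrACA (addrC (- f q')).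
Qed.

End EuclideanCoordinates.

(** * Positive definite functions and displacement on finite quotients *)

Section PositiveDefinite.
Context {R : realType} {G : groupType}.
Implicit Types (phi : G -> R) (g h : G) (c : seq (R * G)).

Record pdef phi : Prop := PDef {
  pdefV : forall g, phi g^-1%g = phi g ;
  pdef_ge0 : forall c, 0 <= kform (translate_kernel phi) c c }.

Lemma pdefZ a phi : 0 <= a -> pdef phi -> pdef (fun g => a * phi g).
Proof.
move=> a0 [pV p0]; split=> [g|c]; first by rewrite pV.
by rewrite [leRHS]kformZK mulr_ge0.
Qed.

Lemma pdef_cnd phi : pdef phi -> cnd (fun g => phi 1%g - phi g).
Proof.
move=> [pV p0]; split=> [|g|c c0]; rewrite ?subrr ?pV//.
have -> : kform (translate_kernel (fun g => phi 1%g - phi g)) c c =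
    kform (fun=> fun=> phi 1%g * 1) c c + -1 * kform (translate_kernel phi) c c.
  rewrite -kformZK -kformDK; apply: eq_kform => x y.
  by rewrite mulr1 mulN1r.
by rewrite kform_prod c0 mulr0 add0r mulN1r oppr_le0.
Qed.

Section Family.
Variable phi : nat -> G -> R.
Hypothesis phiP : forall n, pdef (phi n).

Definition block_kernel (x y : nat * G) : R :=
  (x.1 == y.1)%:R * translate_kernel (phi x.1) x.2 y.2.

Lemma block_kernel_sym x y : block_kernel x y = block_kernel y x.
Proof.
rewrite /block_kernel eq_sym; case: eqP => [->|_]; last by rewrite !mul0r.
by rewrite /translate_kernel -(pdefV (phiP _)) invMg invgK.
Qed.

(** Orthogonal direct sum: the form of [c] is the sum of the forms of its
parts in the blocks. *)
Lemma block_kernel_pos (c : seq (R * (nat * G))) : 0 <= kform block_kernel c c.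
Proof.
(* only the blocks that meet c contribute, so that the sum is finite *)
pose N := (\max_(x <- c) x.2.1).+1.
pose part (n : nat) := [seq ((x.2.1 == n)%:R * x.1, x.2.2) | x <- c].
suff -> : kform block_kernel c c =
    \sum_(n < N) kform (translate_kernel (phi n)) (part n) (part n).
  by apply: sumr_ge0 => n _; exact: pdef_ge0.
rewrite {1}/kform {1}/pairing.
under [RHS]eq_bigr => n _ do rewrite /kform /pairing big_map.
rewrite [RHS]exchange_big; apply: eq_big_seq => x xc /=.
have xN : (x.2.1 < N)%N.
  rewrite ltnS.
  exact: (@leq_bigmax_seq _ _ xpredT (fun z : R * (nat * G) => z.2.1)).
rewrite (bigD1 (Ordinal xN))//= [X in _ + X]big1 ?addr0; last first.
  by move=> n; rewrite -val_eqE/= eq_sym => /negPf ->; rewrite !mul0r.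
rewrite eqxx mul1r; congr (_ * _); rewrite big_map; apply: eq_bigr => y _.
by rewrite /block_kernel eq_sym /=; ring.
Qed.

(** The direct sum of the representations of the [phi n]: a sequence of almost
invariant vectors has to live in one space. *)
Lemma pdef_family_rep : (forall n, phi n 1%g = 1) ->
  exists (H : hilbertType R) (pi : G -> {linear H -> H}) (v : nat -> H),
    [/\ orthogonal_rep pi, forall n, `|v n| = 1 &
      forall n g, `|pi g (v n) - v n| ^+ 2 = (1 - phi n g) *+ 2].
Proof.
move=> phi1; pose K := PSKernel block_kernel_sym block_kernel_pos.
pose act g (x : nat * G) := (x.1, g * x.2)%g.
have [pi [rep pik]] := @kernel_rep R _ K G act
  (fun x => ltac:(by rewrite /act mul1g; case: x))
  (fun g h x => ltac:(by rewrite /act mulgA))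
  (fun g x y => ltac:(by rewrite /= /block_kernel /translate_kernel /= invMg
      -mulgA mulKg)).
exists (rkhs K), pi, (fun n => kvec K (n, 1%g)); split=> // [n|n g].
  apply/eqP; rewrite -(@pexpr_eq1 _ _ 2)//; apply/eqP.
  rewrite normr_kvec /= /block_kernel /translate_kernel /=.
  by rewrite eqxx mulVg phi1 mul1r.
rewrite pik normr_kvecB /= /block_kernel /translate_kernel /= eqxx.
by rewrite !mulg1 mulVg invg1 phi1 (pdefV (phiP _)) !mul1r; ring.
Qed.

End Family.
End PositiveDefinite.

Section Displacement.
Context {R : realType} {G : groupType} {Q : finGroupType}.
Variables (p : {multiplicative G -> Q}).
Implicit Types (f : Q -> R) (g : G).

Lemma multiplicative1 : p 1%g = 1%g.
Proof. by apply: (mulgI (p 1%g)); rewrite -gmulfM !mulg1. Qed.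

(** Matrix coefficient of [f] in the right regular representation of [Q]. *)
Definition coef f g : R := \sum_q f (q * p g)%g * f q.

Definition displacement f g : R := \sum_q (f (q * p g)%g - f q) ^+ 2.

Lemma sum_translate f g : \sum_q f (q * p g)%g = \sum_q f q.
Proof.
by rewrite [RHS](reindex_inj (mulIg (p g))).
Qed.

Lemma displacementE f g : displacement f g = (coef f 1%g - coef f g) *+ 2.
Proof.
have c1 : coef f 1%g = \sum_q f q ^+ 2.
  by apply: eq_bigr => q _; rewrite multiplicative1 mulg1 expr2.
rewrite mulrnBl mulr2n {1}c1 -(sum_translate (fun q => f q ^+ 2) g) c1.
rewrite /coef -sumrMnl -big_split -sumrB; apply: eq_bigr => q _ /=.
by rewrite sqrrB; ring.
Qed.

Lemma coefM f x y :
  coef f (x^-1 * y)%g = \sum_q f (q * p x)%g * f (q * p y)%g.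
Proof.
rewrite /coef (reindex_inj (mulIg (p x))); apply: eq_bigr => q _.
by rewrite -mulgA -gmulfM mulVKg mulrC.
Qed.

(** The power is the coefficient of the tensor power of [f], a function on the
[k]-tuples of elements of [Q]. *)
Lemma coef_pdef f k : pdef (fun g => coef f g ^+ k).
Proof.
split=> [g|c].
  congr (_ ^+ _); have := coefM f g 1%g; rewrite mulg1 => ->.
  by apply: eq_bigr => q _; rewrite multiplicative1 mulg1.
pose F (t : {ffun 'I_k -> Q}) (x : G) := \prod_i f (t i * p x)%g.
rewrite (@eq_kform _ _ _ (fun x y => \sum_t F t x * F t y)); last first.
  move=> x y; rewrite /translate_kernel coefM -[k in LHS]card_ord -prodr_const.
  rewrite bigA_distr_bigA; apply: eq_bigr => t _.
  by rewrite /F -big_split.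
rewrite kform_sum; apply: sumr_ge0 => t _.
by rewrite kform_prod -expr2 sqr_ge0.
Qed.

Lemma displacement_cnd f : cnd (displacement f).
Proof.
have -> : displacement f = 2 *: (fun g => coef f 1%g ^+ 1 - coef f g ^+ 1).
  apply/funext => g; rewrite -[RHS]/(2 * (coef f 1%g ^+ 1 - coef f g ^+ 1)).
  by rewrite displacementE !expr1 mulr_natl.
by apply: cndZ => //; exact: pdef_cnd (coef_pdef f 1).
Qed.

Lemma hilbert_displacement (H : hilbertType R) (f : Q -> H) :
  exists fs : seq (Q -> R), forall g,
    \sum_q `|f (q * p g)%g - f q| ^+ 2 = \sum_(h <- fs) displacement h g.
Proof.
have [fs fsE] := euclidean_coordinates f; exists fs => g.
by rewrite exchange_big; apply: eq_bigr => q _.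
Qed.

End Displacement.

(** * Relative Property T bounds displacement *)

Section PowerEstimates.
Context {R : realType}.
Implicit Types (x z : R) (k : nat).

(** Induction on [k], from [1 - z ^ (k + 1) = (1 - z) + z (1 - z ^ k)]. *)
Lemma one_sub_pow_le z k : `|z| <= 1 -> 0 <= 1 - z ^+ k <= k%:R * (1 - z).
Proof.
move=> z1; have zk m : z ^+ m <= 1.
  by rewrite (le_trans (ler_norm _))// normrX exprn_ile1.
rewrite subr_ge0 zk/=; elim: k => [|k IH]; first by rewrite expr0 subrr mul0r.
have -> : 1 - z ^+ k.+1 = (1 - z) + z * (1 - z ^+ k) by rewrite exprS; ring.
rewrite -natr1 mulrDl mul1r addrC lerD2r (le_trans _ IH)//.
by rewrite ler_piMl ?subr_ge0// (le_trans (ler_norm _)).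
Qed.

Lemma pow_mul_le1 x k : 0 <= x -> x <= 1 -> (1 - x) ^+ k * (1 + k%:R * x) <= 1.
Proof.
move=> x0 x1; elim: k => [|k IH]; first by rewrite expr0 mul0r addr0 mulr1.
apply: le_trans IH; rewrite exprSr -mulrA ler_wpM2l ?exprn_ge0 ?subr_ge0//.
rewrite -natr1; have k0 : 0 <= k%:R :> R by [].
have := mulr_ge0 (mulr_ge0 k0 x0) x0; have := mulr_ge0 x0 x0; lra.
Qed.

(** The exponent is the least integer above [1 / a]. The second bound makes the
k-th power of a coefficient [1 - a] small; the first one limits the loss where
the coefficient is much closer to 1. *)
Lemma separating_power (a : R) : 0 < a -> a <= 2 ->
  exists k : nat, k%:R * a <= 2 /\ (1 - a) ^+ k <= 2^-1.
Proof.
move=> a0 a2; have [a1|a1] := ltP 1 a.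
  by exists 1%N; rewrite mul1r expr1; split=> //; lra.
exists (Num.trunc a^-1).+1.
have av0 : 0 <= a^-1 by rewrite invr_ge0 ltW.
have /andP[t1 t2] := truncn_itv av0.
split.
  rewrite -natr1 mulrDl mul1r -[2]/(1 + 1) lerD//.
  by rewrite -ler_pdivlMr// mul1r.
have ka : 1 <= (Num.trunc a^-1).+1%:R * a.
  by rewrite -ler_pdivrMr// mul1r ltW.
have := pow_mul_le1 (Num.trunc a^-1).+1 (ltW a0) a1.
have : 0 <= (1 - a) ^+ (Num.trunc a^-1).+1 by rewrite exprn_ge0// subr_ge0.
move: ka; move: (_.+1%:R * a) (_ ^+ _) => b c b1 c0 h.
have : c * (1 + 1) <= 1 by rewrite (le_trans _ h)// ler_wpM2l// lerD2l.
by lra.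
Qed.

End PowerEstimates.

Section ScalarRelativeT.
Context {R : realType} {G : groupType} (S : {fset G}).

(** With [u] the displacement scaled so that [1 - u] is the normalised matrix
coefficient of [f], [phi] is the power of [1 - u] that [separating_power] gives
for [a := u y]. *)
Lemma amplified_coefficient (Q : finGroupType) (p : {multiplicative G -> Q})
    (f : Q -> R) (y : G) (C : R) : 0 < C ->
  C * \sum_(s <- S) displacement p f s < displacement p f y ->
  exists phi : G -> R, [/\ pdef phi, phi 1%g = 1, phi y <= 2^-1 &
    \sum_(s <- S) (1 - phi s) <= 2 / C].
Proof.
move=> C0 hy.
have disp_ge0 g : 0 <= displacement p f g by exact/cnd_ge0/displacement_cnd.
have D0 : 0 <= \sum_(s <- S) displacement p f s by exact: sumr_ge0.
have y0 : 0 < displacement p f y by rewrite (le_lt_trans _ hy)// mulr_ge0// ltW.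
have coef1 : coef p f 1%g = \sum_q f q ^+ 2.
  by apply: eq_bigr => q _; rewrite multiplicative1 mulg1 expr2.
have disp_le g : displacement p f g <= coef p f 1%g *+ 4.
  rewrite (_ : _ *+ 4 = \sum_q (f (q * p g)%g ^+ 2 + f q ^+ 2) *+ 2).
    apply: ler_sum => q _; have := sqr_ge0 (f (q * p g)%g + f q).
    by rewrite sqrrB sqrrD; lra.
  rewrite sumrMnl big_split/= (sum_translate p (fun q => f q ^+ 2)) -coef1.
  by ring.
have N0 : 0 < coef p f 1%g by have := disp_le y; lra.
have := displacementE p f.
move: (coef p f 1%g) disp_le N0 => N disp_le N0 dispE.
pose u g := displacement p f g / (N *+ 2).
have N20 : 0 < N *+ 2 by rewrite pmulrn_rgt0.
have u_ge0 g : 0 <= u g by rewrite divr_ge0// ltW.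
have u_le2 g : u g <= 2.
  by rewrite ler_pdivrMr//; have := disp_le g; rewrite mulr_natl; lra.
have u1 g : `|1 - u g| <= 1.
  by rewrite ler_norml; have := u_ge0 g; have := u_le2 g; lra.
have [k [ka k2]] := separating_power (divr_gt0 y0 N20) (u_le2 y).
exists (fun g => (1 - u g) ^+ k).
have uE : (fun g => (1 - u g) ^+ k) = fun g => N^-1 ^+ k * coef p f g ^+ k.
  apply/funext => g; rewrite -exprMn; congr (_ ^+ _).
  by rewrite /u dispE; field; rewrite gt_eqF.
split=> //.
- rewrite uE; apply: pdefZ; last exact: coef_pdef.
  by rewrite exprn_ge0// invr_ge0 ltW.
- by rewrite /u (cnd1 (displacement_cnd _ _)) mul0r subr0 expr1n.
apply: (@le_trans _ _ (\sum_(s <- S) k%:R * u s)).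
  apply: ler_sum => s _; have /andP[_] := one_sub_pow_le k (u1 s).
  by rewrite subKr.
rewrite -mulr_sumr -mulr_suml ler_pdivlMr// -mulrA.
apply: le_trans ka; rewrite ler_wpM2l// -mulrA (mulrC _^-1) mulrA.
by rewrite ler_pM2r ?invr_gt0// mulrC ltW.
Qed.

Lemma relative_T_displacement (Y : set G) : generates S ->
  relative_property_T R Y ->
  exists2 C : R, 0 < C &
    forall (Q : finGroupType) (p : {multiplicative G -> Q}) (f : Q -> R) y,
      Y y -> displacement p f y <= C * \sum_(s <- S) displacement p f s.
Proof.
move=> genS TY; apply: contrapT => noC.
have bad n : exists yphi : G * (G -> R), [/\ Y yphi.1, pdef yphi.2,
    yphi.2 1%g = 1, yphi.2 yphi.1 <= 2^-1 &
    \sum_(s <- S) (1 - yphi.2 s) <= 2 / n.+1%:R].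
  apply: contrapT => nobad; apply: noC; exists n.+1%:R => // Q p f y Yy.
  rewrite leNgt; apply/negP => lt.
  have [phi [h1 h2 h3 h4]] := amplified_coefficient (ltr0Sn R n) lt.
  by apply: nobad; exists (y, phi).
have [yphi yphiP] := choice bad.
have phiP n : pdef (yphi n).2 by have [] := yphiP n.
have phi1 n : (yphi n).2 1%g = 1 by have [] := yphiP n.
have [H [pi [v [rep v1 vE]]]] := pdef_family_rep phiP phi1.
have av : almost_invariant pi v.
  split=> // g; have [L L0 LP] := cnd_le_generators (R := R) genS g.
  have cndphi n : cnd (fun g => 1 - (yphi n).2 g).
    by have := pdef_cnd (phiP n); rewrite phi1.
  have bound n : `|pi g (v n) - v n| ^+ 2 <= (L * 4) * n.+1%:R^-1.
    rewrite vE mulr2n; have := LP _ (cndphi n).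
    have [_ _ _ _ h] := yphiP n; have := ler_wpM2l L0 h.
    by move: (n.+1%:R^-1) (L * \sum_(s <- S) _) => i s; lra.
  have sq0 : `|pi g (v n) - v n| ^+ 2 @[n --> \oo] --> (0 : R).
    apply: (squeeze_cvgr (f := fun=> 0) (h := fun n => (L * 4) * n.+1%:R^-1)).
    - by apply: nearW => n; rewrite sqr_ge0/= bound.
    - exact: cvg_cst.
    - rewrite -[X in _ --> X](mulr0 (L * 4)).
      by apply: cvgMl_tmp; exact: cvg_harmonic.
  have <- : (fun n => Num.sqrt (`|pi g (v n) - v n| ^+ 2)) =
      fun n => `|pi g (v n) - v n|.
    by apply/funext => n; rewrite sqrtr_sqr normr_id.
  rewrite -[X in _ --> X](@sqrtr0 R).
  exact: (continuous_cvg _ (@sqrt_continuous R 0) sq0).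
have := TY H pi v rep av => /cvgr_lt /(_ 1 ltr01) [n _ /(_ n (leqnn n)) /=].
have [Yn _ _ yn _] := yphiP n.
apply/negP; rewrite -leNgt.
have ub : has_ubound [set `|pi y (v n) - v n| | y in Y].
  exists 2 => _ [y _ <-]; rewrite (le_trans (ler_normB _ _))//.
  by rewrite (orep_norm rep) v1.
apply: le_trans (ub_le_sup ub _); last by exists (yphi n).1.
by rewrite -(@ler_pXn2r _ 2)// ?nnegrE// expr1n vE mulr2n; lra.
Qed.

End ScalarRelativeT.

(** * A minimax lemma *)

Section Minimax.
Context {R : realType} {T : eqType}.
Implicit Types (x z : T -> R) (mu : T -> R).

(** When [a] falls short of [C], moving from [a] towards [b] decreases the
squared shortfall at first order in proportion to the product of the shortfall
with [b - a]; when it does not, only a second order term can appear. *)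
Lemma defect_step (B C a b t : R) :
  `|a| <= B -> `|b| <= B -> 0 <= t -> t <= 1 ->
  Num.max 0 (C - ((1 - t) * a + t * b)) ^+ 2 <=
    Num.max 0 (C - a) ^+ 2 - t * (Num.max 0 (C - a) * (b - a)) *+ 2 +
    t ^+ 2 * (`|C| + B) ^+ 2 *+ 4.
Proof.
move=> aB bB t0 t1; set d := C - (_ + _).
have B0 : 0 <= B by exact: le_trans aB.
have CB0 : 0 <= `|C| + B by exact: addr_ge0.
have maxsq (u v : R) : u <= v -> 0 <= v -> Num.max 0 u ^+ 2 <= v ^+ 2.
  by move=> uv v0; rewrite ler_sqr ?nnegrE ?le_max ?lexx// ge_max v0.
have sqle (u v : R) : `|u| <= v -> u ^+ 2 <= v ^+ 2.
  move=> uv; rewrite -real_normK ?num_real// ler_sqr ?nnegrE//.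
  exact: le_trans uv.
have [aC|Ca] := leP 0 (C - a).
  have h1 : Num.max 0 d ^+ 2 <= d ^+ 2.
    by rewrite -[leRHS]real_normK ?num_real// maxsq ?ler_norm.
  have h2 : (b - a) ^+ 2 <= ((`|C| + B) *+ 2) ^+ 2.
    apply: sqle; rewrite (le_trans (ler_normB _ _))// mulr2n lerD//.
      by rewrite (le_trans bB)// lerDr.
    by rewrite (le_trans aB)// lerDr.
  apply: le_trans h1 _.
  have -> : d ^+ 2 = (C - a) ^+ 2 - t * ((C - a) * (b - a)) *+ 2
      + t ^+ 2 * (b - a) ^+ 2 by rewrite /d; ring.
  rewrite lerD2l -mulrnAr ler_wpM2l ?sqr_ge0// (le_trans h2)//.
  by rewrite exprMn_n.
rewrite mul0r mulr0 mul0rn subr0 expr0n/= add0r.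
have dle : d <= t * (`|C| + B).
  have -> : d = (1 - t) * (C - a) + t * (C - b) by rewrite /d; ring.
  rewrite -[leRHS]add0r lerD//.
    by rewrite mulr_ge0_le0 ?subr_ge0// ltW.
  rewrite ler_wpM2l// lerD ?ler_norm//.
  by rewrite (le_trans _ bB)// -normrN ler_norm.
apply: (@le_trans _ _ ((t * (`|C| + B)) ^+ 2)).
  by rewrite maxsq ?mulr_ge0.
rewrite exprMn; have := mulr_ge0 (sqr_ge0 t) (sqr_ge0 (`|C| + B)); lra.
Qed.

(** Take [x] in [A] near the infimum of the total squared shortfall below [C],
and weight the points of [F] by the shortfall of [x]. An element of [A] whose
average for these weights is at least [C] gives a direction along which the
shortfall of [x] decreases at first order; so the infimum is zero. *)
Lemma minimax (F : seq T) (A : set (T -> R)) (B C : R) :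
  A !=set0 ->
  (forall x z t, A x -> A z -> 0 <= t -> t <= 1 -> A ((1 - t) *: x + t *: z)) ->
  (forall x y, A x -> y \in F -> `|x y| <= B) ->
  (forall mu, (forall y, 0 <= mu y) -> \sum_(y <- F) mu y = 1 ->
     exists2 x, A x & C <= \sum_(y <- F) mu y * x y) ->
  forall e, 0 < e -> exists2 x, A x & forall y, y \in F -> C - e <= x y.
Proof.
move=> [x0 Ax0] Aconv Abd Amu e e0; apply: contrapT => none.
pose r x y := Num.max 0 (C - x y).
have r0 x y : 0 <= r x y by rewrite le_max lexx.
pose defect x := \sum_(y <- F) r x y ^+ 2.
have defect_ge x : A x -> e ^+ 2 <= defect x.
  move=> Ax; rewrite leNgt; apply/negP => lt; apply: none; exists x => // y yF.
  rewrite lerBlDr -lerBlDl; apply: (@le_trans _ _ (r x y)).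
    by rewrite le_max lexx orbT.
  rewrite -ler_sqr ?nnegrE// ?ltW//; apply: le_lt_trans lt.
  rewrite /defect (big_rem y)//= lerDl sumr_ge0// => i _; exact: sqr_ge0.
pose D := [set defect x | x in A].
have Dinf : has_inf D.
  split; first by exists (defect x0), x0.
  by exists (e ^+ 2) => _ [x Ax <-]; exact: defect_ge.
have e20 : 0 < e ^+ 2 by rewrite exprn_gt0.
have inf_ge : e ^+ 2 <= inf D.
  by apply: lb_le_inf; [exact: Dinf.1|move=> _ [x Ax <-]; exact: defect_ge].
have inf_gt0 : 0 < inf D by exact: lt_le_trans inf_ge.
pose M : R := \sum_(y <- F) (`|C| + B) ^+ 2 *+ 4.
have M0 : 0 <= M by apply: sumr_ge0 => y _; rewrite mulrn_wge0// sqr_ge0.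
(* a step short enough for the second order term, at most t ^ 2 * M, to cost
   at most half of the first order gain 2 t * inf D *)
pose t := inf D / (inf D + M).
have t0 : 0 < t by rewrite divr_gt0// ltr_pwDl.
have t1 : t <= 1 by rewrite ler_pdivrMr ?ltr_pwDl// mul1r lerDl.
have tM : t * M <= inf D.
  rewrite mulrAC ler_pdivrMr ?ltr_pwDl// ler_wpM2l ?(ltW inf_gt0)//.
  by rewrite lerDr ltW.
have [_ [x Ax <-] xlt] := inf_adherent (mulr_gt0 t0 inf_gt0) Dinf.
have xge : inf D <= defect x by apply: ge_inf; [exact: Dinf.2|exists x].
pose s := \sum_(y <- F) r x y.
have s0 : 0 < s.
  rewrite lt_def sumr_ge0// andbT psumr_eq0//; apply/negP => /allP r_eq0.
  move: (lt_le_trans inf_gt0 xge); rewrite /defect big_seq big1 ?ltxx// => y yF.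
  by rewrite (eqP (r_eq0 _ yF)) expr0n.
have [||z Az zC] := Amu (fun y => r x y / s).
- by move=> y; rewrite divr_ge0// ltW.
- by rewrite -mulr_suml divff// gt_eqF.
have rz : C * s <= \sum_(y <- F) r x y * z y.
  rewrite -ler_pdivlMr// (le_trans zC)// mulr_suml.
  by under [leRHS]eq_bigr do rewrite mulrAC.
have gain : defect x <= \sum_(y <- F) r x y * (z y - x y).
  have -> : defect x = C * s - \sum_(y <- F) r x y * x y.
    rewrite mulr_sumr -sumrB; apply: eq_bigr => y _.
    rewrite (mulrC C) -mulrBr /r; case: (leP 0 (C - x y)) => //.
    by rewrite expr0n mul0r.
  under [leRHS]eq_bigr do rewrite mulrBr.
  by rewrite sumrB lerD2r.
have zle : defect ((1 - t) *: x + t *: z) <=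
    defect x - t * (\sum_(y <- F) r x y * (z y - x y)) *+ 2 + t ^+ 2 * M.
  rewrite /defect !mulr_sumr -sumrMnl -sumrB -big_split.
  rewrite [leLHS]big_seq [leRHS]big_seq.
  apply: ler_sum => y yF /=; rewrite mulrnAr.
  by apply: defect_step; rewrite ?Abd// ltW.
have : inf D <= defect ((1 - t) *: x + t *: z).
  by apply: ge_inf; [exact: Dinf.2|exists ((1 - t) *: x + t *: z) => //;
    apply: Aconv; rewrite // ltW].
have := ler_wpM2l (ltW t0) tM; have := ler_wpM2l (ltW t0) gain.
have := ler_wpM2l (ltW t0) xge.
rewrite [t ^+ 2]expr2 -[in leRHS]mulrA in zle; move: zle xlt.
move: (defect _) (t * inf D) (t * (t * M)) (\sum_(y <- F) _) => *; lra.
Qed.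

End Minimax.

(** * Balls and limits of functions of conditionally negative type *)

Section Balls.
Context {G : groupType} (S : {fset G}).

Fixpoint word_ball (n : nat) : seq G :=
  if n is m.+1 then
    word_ball m ++
      [seq (s * g)%g | s <- S ++ [seq s^-1%g | s <- S], g <- word_ball m]
  else [:: 1%g].

Lemma word_ball_mono m n : (m <= n)%N -> {subset word_ball m <= word_ball n}.
Proof.
move=> /subnKC <-; elim: (n - m)%N => [|k IH] g gm; first by rewrite addn0.
by rewrite addnS /= mem_cat IH.
Qed.

Lemma word_in_ball g w n : words S g w -> (size w <= n)%N -> g \in word_ball n.
Proof.
move=> [wS <-] /word_ball_mono; apply; elim: w wS => [_|s w IH /= /andP[sS wS]].
  by rewrite big_nil inE.
rewrite big_cons mem_cat; apply/orP; right; apply: allpairs_f; last exact: IH.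
rewrite mem_cat; case/orP: sS => [->//|sS]; apply/orP; right.
by apply/mapP; exists s^-1%g => //; rewrite invgK.
Qed.

Lemma generates_in_ball : generates S -> forall g, exists n, g \in word_ball n.
Proof.
move=> genS g; have [w wP] := genS g.
by exists (size w); exact: word_in_ball wP _.
Qed.

Lemma word_dist_ge (R : realType) n g : generates S -> g \notin word_ball n ->
  n%:R <= word_dist R S 1%g g.
Proof.
move=> genS gn; apply: lb_le_inf => [|_ [w wP <-]].
  by have [w wP] := genS (1^-1 * g)%g; exists (size w)%:R, w.
rewrite ler_nat leqNgt; apply: contra gn => /ltnW; apply: word_in_ball.
by rewrite invg1 mul1g in wP.
Qed.

End Balls.

Section Limit.
Context {R : realType} {G : groupType} (S : {fset G}).
Hypothesis genS : generates S.

Definition energy (psi : G -> R) : R := \sum_(s <- S) psi s.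

Lemma energyZ a psi : energy (a *: psi) = a * energy psi.
Proof. by rewrite /energy mulr_sumr. Qed.

Lemma energyD psi psi' : energy (psi + psi') = energy psi + energy psi'.
Proof. exact: big_split. Qed.

Lemma energy_ge0 psi : cnd psi -> 0 <= energy psi.
Proof. by move=> P; apply: sumr_ge0 => s _; exact: cnd_ge0. Qed.

Lemma cnd_uniform_bound : exists L : G -> R, forall g, 0 <= L g /\
  forall psi, cnd psi -> psi g <= L g * energy psi.
Proof.
have /choice[L LP] : forall g, exists l : R, 0 <= l /\
    forall psi, cnd psi -> psi g <= l * energy psi.
  by move=> g; have [l l0 lP] := cnd_le_generators (R := R) genS g; exists l.
by exists L.
Qed.

Lemma sum_half_powers m : \sum_(k < m) (2^-1 : R) ^+ k <= 2.
Proof.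
suff -> : \sum_(k < m) (2^-1 : R) ^+ k = 2 - 2 * 2^-1 ^+ m.
  by rewrite lerBlDr lerDl mulr_ge0// exprn_ge0.
elim: m => [|m IH]; first by rewrite big_ord0 expr0 mulr1 subrr.
by rewrite big_ord_recr IH /= exprS; field.
Qed.

(** On a ball, a weighted sum of the functions given for [C := k 2 ^ k + 1] is
at least [k] outside a ball that depends on [k] only. These sums are uniformly
bounded at each element of [G], so they have a limit along an ultrafilter, which
inherits the lower bounds everywhere and is thus proper. *)
Lemma haagerup_of_local_cnd :
  (forall C : R, 0 < C -> exists n, forall F : seq G, exists psi,
     [/\ cnd psi, energy psi <= 1 &
       forall y, y \in F -> y \notin word_ball S n -> C <= psi y]) ->
  haagerup R G.
Proof.
move=> loc; have [L LP] := cnd_uniform_bound.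
have /choice[N NP] : forall k : nat, exists n, forall m, exists psi : G -> R,
    [/\ cnd psi, energy psi <= 1 & forall y, y \in word_ball S m ->
      y \notin word_ball S n -> k%:R * 2 ^+ k <= psi y].
  move=> k; have [|n nP] := loc (k%:R * 2 ^+ k + 1).
    by rewrite ltr_wpDl// mulr_ge0// exprn_ge0.
  exists n => m; have [psi [P1 P2 P3]] := nP (word_ball S m).
  exists psi; split=> // y ym yn; apply: le_trans (P3 y ym yn).
  by rewrite lerDl.
have /choice[Psi PsiP] : forall km : nat * nat, exists psi : G -> R,
    [/\ cnd psi, energy psi <= 1 & forall y, y \in word_ball S km.2 ->
      y \notin word_ball S (N km.1) -> km.1%:R * 2 ^+ km.1 <= psi y].
  by move=> [k m]; exact: NP.
pose term m k := (2^-1 : R) ^+ k *: Psi (k, m).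
pose f m := \sum_(k < m) term m k.
have half0 k : 0 <= (2^-1 : R) ^+ k by rewrite exprn_ge0.
have termP m k : cnd (term m k) by apply: cndZ => //; have [] := PsiP (k, m).
have fP m : cnd (f m) by apply: cnd_sum => k _.
have fE m g : f m g = \sum_(k < m) term m k g by rewrite /f fct_sumE.
have energy_f m : energy (f m) <= 2.
  apply: le_trans (sum_half_powers m).
  have -> : energy (f m) = \sum_(k < m) energy (term m k).
    by rewrite /energy exchange_big; apply: eq_bigr => s _; rewrite fE.
  apply: ler_sum => k _; rewrite energyZ ler_piMr//.
  by have [] := PsiP (val k, m).
have f_le m g : f m g <= L g * 2.
  have [L0 Lg] := LP g; apply: le_trans (Lg _ (fP m)) _.
  by rewrite ler_wpM2l.
have f_ge k m g : (k < m)%N -> g \in word_ball S m ->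
    g \notin word_ball S (N k) -> k%:R <= f m g.
  move=> km gm gk; rewrite fE (bigD1 (Ordinal km))//=.
  apply: ler_wpDr; first by apply: sumr_ge0 => j _; exact: cnd_ge0.
  have [_ _ /(_ g gm gk) h] := PsiP (k, m).
  rewrite -[leRHS]/(2^-1 ^+ k * Psi (k, m) g) exprVn ler_pdivlMl ?exprn_gt0//.
  by rewrite mulrC.
have [U [UU sU]] := @ultraFilterLemma nat \oo _.
have /choice[psi psiP] : forall g, exists l : R, f m g @[m --> U] --> l.
  move=> g; have PU : ProperFilter ((f ^~ g) @ U) by apply: fmap_proper_filter.
  have [|l [_ cl]] := @segment_compact R 0 (L g * 2) ((f ^~ g) @ U) _.
    apply: (@filterE _ U _ ((f ^~ g) @^-1` `[0, L g * 2])) => m.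
    by rewrite /= in_itv /= f_le andbT; exact: cnd_ge0.
  (* a cluster point of an ultrafilter is a limit *)
  exists l => V Vl /=; have [//|UVC] := in_ultra_setVsetC ((f ^~ g) @^-1` V) UU.
  by have [a [VCa]] := cl (~` V) V UVC Vl.
have psi_ge k g : g \notin word_ball S (N k) -> k%:R <= psi g.
  move=> gk; have [n gn] := generates_in_ball genS g.
  apply: (cvgr_to_ge (psiP g)); apply: sU; exists (maxn n k.+1) => // m /=.
  rewrite geq_max => /andP[nm km]; apply: f_ge => //.
  exact: word_ball_mono gn.
apply: (@proper_cnd_haagerup _ _ psi); first exact: cnd_limit psiP.
move=> r; pose k := (Num.trunc r).+1.
apply: (sub_finite_set _ (finite_seq (word_ball S (N k)))) => g /= gr.
apply/negPn/negP => /psi_ge; rewrite leNgt => /negP; apply.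
by apply: le_lt_trans gr _; exact: truncnS_gt.
Qed.

End Limit.

(** * Measures escaping to infinity *)

Section FarMeasures.
Context {R : realType} {G : groupType} (S : {fset G}).
Hypothesis genS : generates S.

(** The second inequality of the theorem for one measure supported outside
the ball of radius [n], with real-valued functions. *)
Definition spreads (C : R) (n : nat) (mu : {fsfun G -> R with 0}) : Prop :=
  [/\ finitely_supported_probability mu,
      forall g, g \in finsupp mu -> g \notin word_ball S n &
      forall (Q : finGroupType) (p : {multiplicative G -> Q}) (f : Q -> R),
        \sum_(y <- finsupp mu) displacement p f y * mu y
          <= C * energy S (displacement p f)].

(** The functions of conditionally negative type with energy at most 1 form a
convex set, bounded at each point. Every probability measure on the points of
[F] outside the ball gives an average of at least [C] to one of them, a
normalised displacement; minimax yields one function that is good at all these points. *)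
Lemma local_cnd_of_not_spreads (C : R) (n : nat) : 0 < C ->
  (forall mu, ~ spreads C n mu) ->
  forall F : seq G, exists psi, [/\ cnd psi, energy S psi <= 1 &
    forall y, y \in F -> y \notin word_ball S n -> C - 1 <= psi y].
Proof.
move=> C0 nospread F.
pose E : {fset G} := [fset y in [seq y <- F | y \notin word_ball S n]]%fset.
have [L LP] := cnd_uniform_bound (R := R) genS.
pose A : set (G -> R) := [set psi | cnd psi /\ energy S psi <= 1].
suff [psi [P1 P2] P3] :
    exists2 psi, A psi & forall y, y \in E -> C - 1 <= psi y.
  exists psi; split=> // y yF yn; apply: P3.
  by rewrite !inE mem_filter yn.
apply: (@minimax _ _ E A (\sum_(y <- E) L y)) => //.
- by exists (fun=> 0); split; [exact: cnd0|rewrite /energy big1].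
- move=> x z t [x1 x2] [z1 z2] t0 t1; have t1' : 0 <= 1 - t by rewrite subr_ge0.
  split; first by apply: cndD; apply: cndZ.
  rewrite energyD !energyZ -[leRHS](subrK t) lerD//.
    by rewrite ler_piMr.
  by rewrite ler_piMr.
- move=> psi y [P1 P2] yE; rewrite ger0_norm ?cnd_ge0//.
  have [L0 /(_ _ P1) h] := LP y; apply: le_trans h _.
  apply: (@le_trans _ _ (L y)); first by rewrite ler_piMr.
  rewrite (big_rem y)//= lerDl sumr_ge0// => g _.
  by have [] := LP g.
move=> m m0 m1.
pose mu : {fsfun G -> R with 0} := [fsfun y in E => m y].
have supp : (finsupp mu `<=` E)%fset by exact: finsupp_sub.
have sumE (w : G -> R) :
    \sum_(y <- finsupp mu) w y * mu y = \sum_(y <- E) m y * w y.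
  rewrite (big_fset_incl _ supp) => [|y _ ys]; last first.
    by rewrite fsfun_dflt ?mulr0.
  by apply: eq_big_seq => y yE; rewrite fsfunE yE mulrC.
have muP : finitely_supported_probability mu.
  split=> [y|]; first by rewrite fsfunE; case: ifP.
  rewrite -m1; have := sumE (fun=> 1).
  by under eq_bigr do rewrite mul1r; under [RHS]eq_bigr do rewrite mulr1.
have far y : y \in finsupp mu -> y \notin word_ball S n.
  by move=> /(fsubsetP supp); rewrite !inE mem_filter => /andP[].
have [Q [p [f lt]]] : exists (Q : finGroupType) (p : {multiplicative G -> Q}) f,
    C * energy S (displacement p f) <
      \sum_(y <- finsupp mu) displacement p f y * mu y.
  apply: contrapT => none; apply: (nospread mu); split=> // Q p f.
  by rewrite leNgt; apply/negP => lt; apply: none; exists Q, p, f.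
have P := displacement_cnd p f; have e0 := energy_ge0 S P.
(* a function of conditionally negative type that vanishes on S vanishes, as S
   generates G; so the displacement can be normalised *)
have e1 : 0 < energy S (displacement p f).
  rewrite lt_def e0 andbT; apply: contraTneq lt => eq0.
  rewrite eq0 mulr0 -leNgt big1// => y _.
  have [_ /(_ _ P)] := LP y; rewrite eq0 mulr0 => y0.
  have /eqP -> : displacement p f y == 0 by rewrite eq_le y0 cnd_ge0.
  by rewrite mul0r.
exists ((energy S (displacement p f))^-1 *: displacement p f).
  split; first by apply: cndZ; rewrite ?invr_ge0.
  by rewrite energyZ mulVf// gt_eqF.
rewrite -sumE; under eq_bigr => y _ do
  rewrite -[X in X * _]/(_^-1 * displacement p f y) -mulrA.
by rewrite -mulr_sumr ler_pdivlMl// mulrC ltW.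
Qed.

Lemma spreading_measures : ~ haagerup R G ->
  exists2 C : R, 0 < C & forall n, exists mu, spreads C n mu.
Proof.
move=> nH; apply: contrapT => noC; apply: nH.
apply: (haagerup_of_local_cnd genS) => C C0.
have C1 : 0 < C + 1 by rewrite addr_gt0.
have [n nP] : exists n, forall mu, ~ spreads (C + 1) n mu.
  apply: contrapT => h; apply: noC; exists (C + 1) => // n.
  by apply: contrapT => h'; apply: h; exists n => mu sp; apply: h'; exists mu.
exists n => F; have [psi [P1 P2 P3]] := local_cnd_of_not_spreads C1 nP F.
by exists psi; split=> // y yF yn; rewrite -[C](addrK 1); exact: P3.
Qed.

Lemma word_dist_set_ge (n : nat) (W : set G) : W !=set0 ->
  (forall g, W g -> g \notin word_ball S n) -> n%:R <= word_dist_set R S 1%g W.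
Proof.
move=> [g Wg] far; apply: lb_le_inf; first by exists (word_dist R S 1%g g), g.
by move=> _ [h Wh <-]; apply: word_dist_ge => //; exact: far.
Qed.

End FarMeasures.

(** * Displacement inequalities on finite quotients *)

Theorem proposition3 (R : realType) (G : groupType) (S : {fset G})
    (genS : generates S) :
  (forall Y : set G, infinite_set Y -> relative_property_T R Y ->
     exists C : R, 0 < C /\
       forall (Q : finGroupType) (p : {multiplicative G -> Q}),
         quotient_map p ->
         forall (H : hilbertType R) (f : Q -> H) (y : G), Y y ->
           \sum_(g : Q) `|f (g * p y)%g - f g| ^+ 2
             <= C * \sum_(g : Q) \sum_(s <- S) `|f (g * p s)%g - f g| ^+ 2)
  /\
  (~ haagerup R G ->
     exists (C : R) (mu : nat -> {fsfun G -> R with 0}),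
       [/\ 0 < C,
           forall n, finitely_supported_probability (mu n),
           word_dist_set R S 1%g [set` finsupp (mu n)] @[n --> \oo] --> +oo &
           forall (n : nat) (Q : finGroupType) (p : {multiplicative G -> Q}),
             quotient_map p ->
             forall (H : hilbertType R) (f : Q -> H),
               \sum_(g : Q)
                 (\sum_(y <- finsupp (mu n)) `|f (g * p y)%g - f g| ^+ 2 * mu n y)
               <= C * \sum_(g : Q) \sum_(s <- S) `|f (g * p s)%g - f g| ^+ 2]).
Proof.
split.
  move=> Y _ TY; have [C C0 CP] := relative_T_displacement genS TY.
  exists C; split=> // Q p _ H f y Yy.
  have [fs fsE] := hilbert_displacement p f.
  rewrite exchange_big /= fsE; under eq_bigr do rewrite fsE.
  rewrite [X in _ <= _ * X]exchange_big mulr_sumr.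
  by apply: ler_sum => h _; exact: CP.
move=> /(spreading_measures genS)[C C0 /choice[mu muP]]; exists C, mu.
split=> // [n||n Q p _ H f]; first by have [] := muP n.
- apply/cvgryPge => A; exists (Num.trunc A).+1 => // n /= An.
  have [[_ mu1] far _] := muP n.
  have [g mug] : [set` finsupp (mu n)] !=set0.
    apply/set0P/negP => /eqP e; move: mu1; rewrite big_seq big1 => [|g gmu].
      by move/eqP; rewrite eq_sym oner_eq0.
    have : [set` finsupp (mu n)] g by [].
    by rewrite e.
  apply: (@le_trans _ _ n%:R).
    by rewrite ltW// (lt_le_trans (truncnS_gt A))// ler_nat.
  by apply: word_dist_set_ge => //; exists g.
have [_ _ spread] := muP n; have [fs fsE] := hilbert_displacement p f.
rewrite [leRHS]mulrC exchange_big [X in _ <= X * _]exchange_big /= mulrC.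
under eq_bigr => y _ do rewrite -mulr_suml fsE mulr_suml.
under [X in _ <= _ * X]eq_bigr do rewrite fsE.
rewrite exchange_big [X in _ <= _ * X]exchange_big mulr_sumr /=.
apply: ler_sum => h _; exact: spread.
Qed.
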